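(* Let $G$ be a group and let $F$ be the (homogeneous) standard resolution of $\mathbb{Z}$ over $\mathbb{Z}G$. (i) Let $s\in G$ and let $\phi_s:F\to F[1]$ be a $G$-linear graded map satisfying $\phi_s:\tau_s\approx 1$, i.e. $\tau_s-1=\partial\phi_s+\phi_s\partial$. Then for every $G$-module $M$ the map $h_s=\phi_s^*:C(G,M)\to C(G,M)[-1]$, given by $h_s(a)=a\phi_s$, satisfies $h_s:s\approx 1$, i.e. $$sa-a=(h_sd+dh_s)(a)\qquad\forall a\in C(G,M).$$ (ii) Let $\lambda:F\to (F\otimes F)[1]$ be a $G$-linear graded map satisfying $\lambda:\tau\Delta\approx\Delta$, i.e. $\tau\Delta-\Delta=\partial\lambda+\lambda\partial$. Then for all $G$-modules $M$ and $N$ the map $h=\lambda^*\times: C(G,M)\otimes C(G,N)\to C(G,M\otimes N)[-1]$, given by $h(a\otimes b)=(a\times b)\lambda$, satisfies $h:\bar\cup\approx\cup$, i.e. $$(-1)^{pq}t_*(b\cup a)-a\cup b=(hd+dh)(a\otimes b)\qquad\forall a\in C^p(G,M),\ b\in C^q(G,N).$$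
   Context: Tensor products are over $\mathbb{Z}$, with diagonal $G$-action. $F$ is the standard resolution: $F_n=\mathbb{Z}G^{n+1}$ for $n\ge 0$ (free abelian group on $G^{n+1}$, with $u(s_0,\ldots,s_n)=(us_0,\ldots,us_n)$ for $u\in G$), with boundary $\partial(s_0,\ldots,s_n)=\sum_{i=0}^n(-1)^i(s_0,\ldots,\hat s_i,\ldots,s_n)$ for $n\ge1$ and $\partial=0$ on $F_0$. On $F\otimes F$ the boundary is $\partial(x\otimes y)=\partial x\otimes y+(-1)^{\deg x}x\otimes\partial y$. Shifts: for a chain complex, $F'[1]_n=F'_{n+1}$; for a cochain complex, $P[-1]^n=P^{n-1}$. For maps $f,g$ of chain complexes, $h:f\approx g$ means that $h$ is a graded (module-linear) map raising degree by one with $f-g=\partial h+h\partial$. For maps $f,g$ of cochain complexes, $h:f\approx g$ means that $h$ is a graded map lowering degree by one with $f-g=hd+dh$. For a $G$-module $M$, $C(G,M)=\mathrm{Hom}_G(F,M)$, i.e. $C^n(G,M)=\mathrm{Hom}_G(F_n,M)$, with $(da)(x)=a(\partial x)$ (no sign). On $C(G,M)\otimes C(G,N)$, $d(a\otimes b)=da\otimes b+(-1)^pa\otimes db$ for $a\in C^p(G,M)$. Cochains $a\in C^n(G,M)$ are extended by zero to $F_m$, $m\ne n$. For $s\in G$, $\tau_s:F\to F$ is the chain map $(s_0,\ldots,s_n)\mapsto(s_0s,\ldots,s_ns)$. $G$ acts on $C(G,M)$ by $(sa)(s_0,\ldots,s_n)=s\,a(s^{-1}s_0s,\ldots,s^{-1}s_ns)=a(s_0s,\ldots,s_ns)$.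 $\tau:F\otimes F\to F\otimes F$ is $x\otimes y\mapsto(-1)^{\deg x\deg y}y\otimes x$. $\Delta:F\to F\otimes F$ is the Alexander–Whitney map $(s_0,\ldots,s_n)\mapsto\sum_{i=0}^n(s_0,\ldots,s_i)\otimes(s_i,\ldots,s_n)$. For $a\in C^p(G,M)$, $b\in C^q(G,N)$, $a\times b\in\mathrm{Hom}_G(F\otimes F,M\otimes N)$ is $(a\times b)(x\otimes y)=a(x)\otimes b(y)$ (zero outside $F_p\otimes F_q$), and $\times$ also denotes the induced map $a\otimes b\mapsto a\times b$. The cup product is $a\cup b=(a\times b)\Delta\in C^{p+q}(G,M\otimes N)$. $t:N\otimes M\to M\otimes N$ is $\beta\otimes\alpha\mapsto\alpha\otimes\beta$ and $t_*(c)=t\circ c$. The map $\bar\cup:C(G,M)\otimes C(G,N)\to C(G,M\otimes N)$ is $a\bar\cup b=(-1)^{pq}t_*(b\cup a)$. *)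

(* Defs.v *)
From HB Require Import structures.
From mathcomp Require Import all_boot all_algebra boolp zify freeg.

Set Implicit Arguments.
Unset Strict Implicit.
Unset Printing Implicit Defensive.

Import GRing.Theory.
Local Open Scope ring_scope.

Lemma additive_ext (U V : zmodType) (f g : {additive U -> V}) : f =1 g -> f = g.
Proof.
move=> /funext; case: f => f [[fD]]; case: g => g [[gD]] /= fg.
by case: g / fg gD => gD; rewrite (Prop_irrelevance fD gD).
Qed.

Lemma raddf_sgn (U V : zmodType) (f : {additive U -> V}) k x :
  f (x *~ (-1) ^+ k) = f x *~ (-1) ^+ k.
Proof. exact: raddfMz. Qed.

Section FreeAbelian.
Variable K : choiceType.

Definition fgen (k : K) : {freeg K} := << k >>.

Definition free_lift (M : zmodType) (f : K -> M) (x : {freeg K}) : M :=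
  fglift (f : K -> zmodule M) x.

Lemma free_lift_is_additive (M : zmodType) (f : K -> M) :
  zmod_morphism (free_lift f).
Proof. exact: (@lift_is_additive _ K (zmodule M) f). Qed.

HB.instance Definition _ (M : zmodType) (f : K -> M) :=
  GRing.isZmodMorphism.Build {freeg K} M (free_lift f) (free_lift_is_additive f).

Lemma free_lift_gen (M : zmodType) (f : K -> M) k : free_lift f (fgen k) = f k.
Proof. by rewrite /free_lift /fgen liftU. Qed.

Lemma free_ext (M : zmodType) (f g : {additive {freeg K} -> M}) :
  (forall k, f (fgen k) = g (fgen k)) -> f =1 g.
Proof.
move=> fg x; rewrite -[x]freeg_sumE !raddf_sum; apply: eq_bigr => k _.
have -> : << coeff k x *g k >> = fgen k *~ coeff k x :> {freeg K}.
  by rewrite /fgen freeg_mulz intz.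
by rewrite !raddfMz fg.
Qed.

End FreeAbelian.

(* Biadditive maps and the tensor product over Z: the quotient of the free
   abelian group on pairs by the subgroup generated by the bilinear relations. *)

Record biadd (M N P : zmodType) := Biadd {
  biadd_fun :> M -> N -> P;
  biaddDl : forall n, {morph biadd_fun^~ n : m m' / m + m'};
  biaddDr : forall m, {morph biadd_fun m : n n' / n + n'} }.

Section Tensor.
Variables M N : zmodType.

Inductive bilin_rel : {freeg (M * N)%type} -> Prop :=
| BilinRel0 : bilin_rel 0
| BilinRelB x y : bilin_rel x -> bilin_rel y -> bilin_rel (x - y)
| BilinRelDl m m' n :
    bilin_rel (fgen (m + m', n) - (fgen (m, n) + fgen (m', n)))
| BilinRelDr m n n' :
    bilin_rel (fgen (m, n + n') - (fgen (m, n) + fgen (m, n'))).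

Definition bilin_pred : {pred {freeg (M * N)%type}} := fun x => `[< bilin_rel x >].

Lemma bilin_pred_zmod : zmod_closed bilin_pred.
Proof.
split=> [|x y /asboolP rx /asboolP ry]; apply/asboolP; first exact: BilinRel0.
exact: BilinRelB.
Qed.

HB.instance Definition _ :=
  GRing.isZmodClosed.Build {freeg (M * N)%type} bilin_pred bilin_pred_zmod.

Definition tensor : Type := Quotient.quot bilin_pred.
HB.instance Definition _ := GRing.Zmodule.on tensor.

Definition tproj (x : {freeg (M * N)%type}) : tensor := \pi_(Quotient.quot bilin_pred)%qT x.

Lemma tproj_is_additive : zmod_morphism tproj.
Proof. exact: pi_is_zmod_morphism. Qed.

HB.instance Definition _ :=
  GRing.isZmodMorphism.Build {freeg (M * N)%type} tensor tproj tproj_is_additive.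

Definition pure (m : M) (n : N) : tensor := tproj (fgen (m, n)).

Lemma tproj_eq x y : bilin_rel (x - y) -> tproj x = tproj y.
Proof.
by move=> rxy; apply/eqP; rewrite -(Quotient.idealrBE bilin_pred); apply/asboolP.
Qed.

Lemma pureDl m m' n : pure (m + m') n = pure m n + pure m' n.
Proof. by rewrite /pure -raddfD; apply/tproj_eq/BilinRelDl. Qed.

Lemma pureDr m n n' : pure m (n + n') = pure m n + pure m n'.
Proof. by rewrite /pure -raddfD; apply/tproj_eq/BilinRelDr. Qed.

Definition pure_biadd : biadd M N tensor :=
  Biadd (fun n m m' => pureDl m m' n) (fun m n n' => pureDr m n n').

Lemma tensor_ext (P : zmodType) (f g : {additive tensor -> P}) :
  (forall m n, f (pure m n) = g (pure m n)) -> f =1 g.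
Proof.
move=> fg t; rewrite -[t](reprK t) -/(tproj (repr t)).
apply: (free_ext (f := f \o tproj) (g := g \o tproj)) => -[m n]; exact: fg.
Qed.

Definition tensor_lift (P : zmodType) (f : M -> N -> P) (t : tensor) : P :=
  free_lift (fun mn => f mn.1 mn.2) (repr t).

Section Lift.
Variables (P : zmodType) (f : biadd M N P).

Lemma bilin_rel_lift x :
  bilin_rel x -> free_lift (fun mn => f mn.1 mn.2) x = 0.
Proof.
elim=> [|y z _ y0 _ z0|m m' n|m n n']; first exact: raddf0.
- by rewrite raddfB /= y0 z0 subrr.
- by rewrite raddfB raddfD /= !free_lift_gen /= biaddDl subrr.
- by rewrite raddfB raddfD /= !free_lift_gen /= biaddDr subrr.
Qed.

Lemma tensor_lift_proj x :
  tensor_lift f (tproj x) = free_lift (fun mn => f mn.1 mn.2) x.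
Proof.
apply/eqP; rewrite -subr_eq0 -raddfB; apply/eqP/bilin_rel_lift/asboolP.
by rewrite -[`[< _ >]]/(_ \in bilin_pred) Quotient.idealrBE reprK.
Qed.

Lemma tensor_lift_is_additive : zmod_morphism (tensor_lift f).
Proof.
move=> s t; rewrite -[s](reprK s) -[t](reprK t).
rewrite -/(tproj (repr s)) -/(tproj (repr t)) -raddfB !tensor_lift_proj.
exact: raddfB.
Qed.

HB.instance Definition _ :=
  GRing.isZmodMorphism.Build tensor P (tensor_lift f) tensor_lift_is_additive.

Lemma tensor_lift_pure m n : tensor_lift f (pure m n) = f m n.
Proof. by rewrite tensor_lift_proj free_lift_gen. Qed.

End Lift.
End Tensor.

Section BiaddComp.
Variables (M N P : zmodType).

Definition biadd_flip (f : biadd M N P) : biadd N M P :=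
  Biadd (biadd_fun := fun n m => f m n)
    (fun m => @biaddDr _ _ _ f m) (fun n => @biaddDl _ _ _ f n).

Lemma biadd_compDl (M' N' P' : zmodType) (f : biadd M N P) (g : {additive P -> P'})
    (a : {additive M' -> M}) (b : {additive N' -> N}) n :
  {morph (fun m => g (f (a m) (b n))) : m m' / m + m'}.
Proof. by move=> m m' /=; rewrite raddfD biaddDl raddfD. Qed.

Lemma biadd_compDr (M' N' P' : zmodType) (f : biadd M N P) (g : {additive P -> P'})
    (a : {additive M' -> M}) (b : {additive N' -> N}) m :
  {morph (fun n => g (f (a m) (b n))) : n n' / n + n'}.
Proof. by move=> n n' /=; rewrite raddfD biaddDr raddfD. Qed.

Definition biadd_comp (M' N' P' : zmodType) (f : biadd M N P)
    (g : {additive P -> P'}) (a : {additive M' -> M}) (b : {additive N' -> N}) :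
    biadd M' N' P' :=
  Biadd (biadd_compDl f g a b) (biadd_compDr f g a b).

Section BiaddTheory.
Variable f : biadd M N P.
Lemma biadd0l n : f 0 n = 0.
Proof. by apply: (addrI (f 0 n)); rewrite -biaddDl !addr0. Qed.
Lemma biadd0r m : f m 0 = 0.
Proof. by apply: (addrI (f m 0)); rewrite -biaddDr !addr0. Qed.
Lemma biadd_zmodl n : zmod_morphism (f^~ n).
Proof.
move=> m m'; apply: (addIr (f m' n)).
by rewrite -biaddDl !subrK.
Qed.
Lemma biadd_zmodr m : zmod_morphism (f m).
Proof.
move=> n n'; apply: (addIr (f m n')).
by rewrite -biaddDr !subrK.
Qed.
End BiaddTheory.
End BiaddComp.

Section PureTheory.
Variables (M N : zmodType).

HB.instance Definition _ (m : M) := GRing.isZmodMorphism.Build N (tensor M N)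
  (pure m) (biadd_zmodr (pure_biadd M N) m).

Lemma pure0l (n : N) : pure (0 : M) n = 0.
Proof. exact: (biadd0l (pure_biadd M N)). Qed.

Lemma pure_suml (I : Type) (r : seq I) (F : I -> M) (n : N) :
  pure (\sum_(i <- r) F i) n = \sum_(i <- r) pure (F i) n.
Proof.
elim: r => [|i r IH]; first by rewrite !big_nil pure0l.
by rewrite !big_cons pureDl IH.
Qed.

Lemma pureMzl (m : M) (n : N) k : pure (m *~ k) n = pure m n *~ k.
Proof.
pose g := GRing.isZmodMorphism.Build _ _ (fun m => pure m n) (biadd_zmodl (pure_biadd M N) n).
pose h : {additive M -> tensor M N} := HB.pack (fun m => pure m n) g.
exact: (raddfMz h).
Qed.

End PureTheory.

Section TensorMap.
Variables (M N M' N' : zmodType).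

Definition tensor_map (f : {additive M -> M'}) (g : {additive N -> N'}) :
    tensor M N -> tensor M' N' :=
  tensor_lift (biadd_comp (pure_biadd M' N') idfun f g).

HB.instance Definition _ f g := GRing.Additive.on (tensor_map f g).

Lemma tensor_map_pure f g m n : tensor_map f g (pure m n) = pure (f m) (g n).
Proof. exact: tensor_lift_pure. Qed.

Lemma tensor_mapDl (f f' : {additive M -> M'}) (g : {additive N -> N'}) t :
  tensor_map (f \+ f') g t = tensor_map f g t + tensor_map f' g t.
Proof.
apply: (tensor_ext (g := tensor_map f g \+ tensor_map f' g)) => m n /=.
by rewrite !tensor_map_pure pureDl.
Qed.

Lemma tensor_mapDr (f : {additive M -> M'}) (g g' : {additive N -> N'}) t :
  tensor_map f (g \+ g') t = tensor_map f g t + tensor_map f g' t.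
Proof.
apply: (tensor_ext (g := tensor_map f g \+ tensor_map f g')) => m n /=.
by rewrite !tensor_map_pure pureDr.
Qed.

Definition tensor_swap : tensor M N -> tensor N M :=
  tensor_lift (biadd_flip (pure_biadd N M)).

HB.instance Definition _ := GRing.Additive.on tensor_swap.

Lemma tensor_swap_pure m n : tensor_swap (pure m n) = pure n m.
Proof. exact: tensor_lift_pure. Qed.

End TensorMap.

Lemma tensor_map_comp (M N M' N' M'' N'' : zmodType)
    (f : {additive M -> M'}) (g : {additive N -> N'})
    (f' : {additive M' -> M''}) (g' : {additive N' -> N''}) t :
  tensor_map f' g' (tensor_map f g t) = tensor_map (f' \o f) (g' \o g) t.
Proof.
apply: (tensor_ext (f := tensor_map f' g' \o tensor_map f g)) => m n /=.
by rewrite !tensor_map_pure.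
Qed.

HB.mixin Record isGModule (G : groupType) M of GRing.Zmodule M := {
  gact : G -> M -> M;
  gact1 : forall x, gact 1%g x = x;
  gactM : forall s u x, gact (s * u)%g x = gact s (gact u x);
  gactD : forall s, {morph gact s : x y / x + y} }.

#[short(type="gmodType")]
HB.structure Definition GModule (G : groupType) :=
  {M of isGModule G M & GRing.Zmodule M}.

Section GModuleTheory.
Variables (G : groupType) (M : gmodType G).

Lemma gact_is_additive (s : G) : zmod_morphism (@gact G M s).
Proof. by move=> x y; apply: (addIr (gact s y)); rewrite -gactD !subrK. Qed.

HB.instance Definition _ (s : G) :=
  GRing.isZmodMorphism.Build M M (@gact G M s) (gact_is_additive s).

End GModuleTheory.

Record ghom (G : groupType) (M N : gmodType G) := GHom {
  ghom_fun :> {additive M -> N};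
  ghomJ : forall (s : G) x, ghom_fun (gact s x) = gact s (ghom_fun x) }.

Section GHomZmodule.
Variables (G : groupType) (M N : gmodType G).
Implicit Types f g : ghom M N.

Lemma ghom_ext f g : f =1 g -> f = g.
Proof.
case: f => f fJ; case: g => g gJ /= /additive_ext fg.
by case: g / fg gJ => gJ; rewrite (Prop_irrelevance fJ gJ).
Qed.

HB.instance Definition _ := gen_eqMixin (ghom M N).
HB.instance Definition _ := gen_choiceMixin (ghom M N).

Lemma ghom_zeroJ (s : G) x :
  (\0%R : {additive M -> N}) (gact s x) = gact s ((\0%R : {additive M -> N}) x).
Proof. by rewrite /= raddf0. Qed.
Lemma ghom_oppJ f (s : G) x : (\- f) (gact s x) = gact s ((\- f) x).
Proof. by rewrite /= ghomJ raddfN. Qed.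
Lemma ghom_addJ f g (s : G) x : (f \+ g) (gact s x) = gact s ((f \+ g) x).
Proof. by rewrite /= !ghomJ raddfD. Qed.

Definition ghom_zero : ghom M N := GHom ghom_zeroJ.
Definition ghom_opp f : ghom M N := GHom (ghom_oppJ f).
Definition ghom_add f g : ghom M N := GHom (ghom_addJ f g).

Lemma ghom_addA : associative ghom_add.
Proof. by move=> f g h; apply: ghom_ext => x /=; rewrite addrA. Qed.
Lemma ghom_addC : commutative ghom_add.
Proof. by move=> f g; apply: ghom_ext => x /=; rewrite addrC. Qed.
Lemma ghom_add0 : left_id ghom_zero ghom_add.
Proof. by move=> f; apply: ghom_ext => x /=; rewrite add0r. Qed.
Lemma ghom_addN : left_inverse ghom_zero ghom_opp ghom_add.
Proof. by move=> f; apply: ghom_ext => x /=; rewrite addNr. Qed.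

HB.instance Definition _ := GRing.isZmodule.Build (ghom M N)
  ghom_addA ghom_addC ghom_add0 ghom_addN.

Lemma ghomDE f g x : (f + g) x = f x + g x. Proof. by []. Qed.
Lemma ghomNE f x : (- f) x = - f x. Proof. by []. Qed.
Lemma ghom0E x : (0 : ghom M N) x = 0. Proof. by []. Qed.
Lemma ghomMnE f k x : (f *+ k) x = f x *+ k.
Proof. by elim: k => [|k IH]; rewrite ?mulr0n // !mulrS ghomDE IH. Qed.
Lemma ghomMzE f k x : (f *~ k) x = f x *~ k.
Proof. by case: k => k; rewrite ?NegzE ?mulrNz ?ghomNE -?pmulrn ghomMnE. Qed.

End GHomZmodule.

Section GHomComp.
Variables (G : groupType).

Lemma ghom_idJ (M : gmodType G) (s : G) (x : M) :
  idfun (gact s x) = gact s (idfun x).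
Proof. by []. Qed.
Definition ghom_id (M : gmodType G) : ghom M M := GHom (@ghom_idJ M).

Lemma ghom_compJ (M N P : gmodType G) (g : ghom N P) (f : ghom M N) (s : G) x :
  (g \o f) (gact s x) = gact s ((g \o f) x).
Proof. by rewrite /= !ghomJ. Qed.
Definition ghom_comp (M N P : gmodType G) (g : ghom N P) (f : ghom M N) :
  ghom M P := GHom (ghom_compJ g f).

Definition precomp (M N P : gmodType G) (f : ghom M N) (g : ghom N P) :
  ghom M P := ghom_comp g f.
Lemma precomp_is_additive (M N P : gmodType G) (f : ghom M N) :
  zmod_morphism (@precomp M N P f).
Proof. by move=> g h; apply: ghom_ext. Qed.
HB.instance Definition _ (M N P : gmodType G) (f : ghom M N) :=
  GRing.isZmodMorphism.Build (ghom N P) (ghom M P) (precomp f)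
    (@precomp_is_additive M N P f).

Definition postcomp (M N P : gmodType G) (g : ghom N P) (f : ghom M N) :
  ghom M P := ghom_comp g f.
Lemma postcomp_is_additive (M N P : gmodType G) (g : ghom N P) :
  zmod_morphism (@postcomp M N P g).
Proof. by move=> f h; apply: ghom_ext => x /=; rewrite raddfB. Qed.
HB.instance Definition _ (M N P : gmodType G) (g : ghom N P) :=
  GRing.isZmodMorphism.Build (ghom M N) (ghom M P) (postcomp g)
    (@postcomp_is_additive M N P g).

End GHomComp.

Section TensorGModule.
Variables (G : groupType) (M N : gmodType G).

Definition tensor_act (s : G) : tensor M N -> tensor M N :=
  tensor_map (@gact G M s) (@gact G N s).

Lemma tensor_act1 t : tensor_act 1%g t = t.
Proof.
apply: (tensor_ext (f := tensor_map _ _) (g := idfun)) => m n /=.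
by rewrite tensor_map_pure /= !gact1.
Qed.
Lemma tensor_actM s u t : tensor_act (s * u)%g t = tensor_act s (tensor_act u t).
Proof.
apply: (tensor_ext (f := tensor_map _ _) (g := tensor_map _ _ \o tensor_map _ _)).
by move=> m n /=; rewrite !tensor_map_pure /= !gactM.
Qed.
Lemma tensor_actD s : {morph tensor_act s : x y / x + y}.
Proof. by move=> x y; rewrite /tensor_act raddfD. Qed.

HB.instance Definition _ := isGModule.Build G (tensor M N)
  tensor_act1 tensor_actM tensor_actD.

Lemma gact_tensor (s : G) (t : tensor M N) :
  gact s t = tensor_map (@gact G M s) (@gact G N s) t.
Proof. by []. Qed.

End TensorGModule.

Section TensorGHom.
Variables (G : groupType) (M N M' N' : gmodType G).

Lemma tensor_mapJ (f : ghom M M') (g : ghom N N') (s : G) (t : tensor M N) :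
  tensor_map f g (gact s t) = gact s (tensor_map f g t).
Proof.
rewrite !gact_tensor !tensor_map_comp.
apply: (tensor_ext (f := tensor_map _ _) (g := tensor_map _ _)) => m n /=.
by rewrite !tensor_map_pure /= !ghomJ.
Qed.

Definition tensor_ghom (f : ghom M M') (g : ghom N N') :
  ghom (tensor M N) (tensor M' N') := GHom (tensor_mapJ f g).

Lemma tensor_swapJ (s : G) (t : tensor M N) :
  tensor_swap (gact s t) = gact s (tensor_swap t).
Proof.
rewrite !gact_tensor.
apply: (tensor_ext (f := @tensor_swap _ _ \o tensor_map _ _)
                   (g := tensor_map _ _ \o @tensor_swap _ _)) => m n /=.
by rewrite tensor_map_pure !tensor_swap_pure tensor_map_pure.
Qed.

Definition swap_ghom : ghom (tensor M N) (tensor N M) := GHom tensor_swapJ.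

End TensorGHom.

(* Complexes are indexed by nat and vanish in negative degrees. *)

Record chain_complex (G : groupType) := ChainComplex {
  chain_obj :> nat -> gmodType G;
  bd : forall n, ghom (chain_obj n.+1) (chain_obj n);
  bd_bd : forall n x, bd n (bd n.+1 x) = 0 }.

Record chain_map (G : groupType) (X Y : chain_complex G) := ChainMap {
  chain_fun :> forall n, ghom (X n) (Y n);
  chain_map_bd : forall n x,
    chain_fun n (bd X n x) = bd Y n (chain_fun n.+1 x) }.

(* [shifted X Y] is the type of graded G-linear maps X -> Y[1]. *)
Definition shifted (G : groupType) (X Y : chain_complex G) : Type :=
  forall n, ghom (X n) (Y n.+1).

(* h : f ~ g, i.e. f - g = bd h + h bd; on X_0 the summand h bd is zero. *)
Definition chain_homotopy (G : groupType) (X Y : chain_complex G)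
    (f g : chain_map X Y) (h : shifted X Y) : Prop :=
  (forall x : X 0%N, f 0%N x - g 0%N x = bd Y 0 (h 0%N x)) /\
  (forall n (x : X n.+1),
     f n.+1 x - g n.+1 x = bd Y n.+1 (h n.+1 x) + h n (bd X n x)).

Section ChainMaps.
Variable G : groupType.
Implicit Types X Y Z : chain_complex G.

Definition chain_id X : chain_map X X :=
  @ChainMap G X X (fun n => ghom_id (X n)) (fun _ _ => erefl).

Lemma chain_comp_bd X Y Z (g : chain_map Y Z) (f : chain_map X Y) n x :
  ghom_comp (g n) (f n) (bd X n x) = bd Z n (ghom_comp (g n.+1) (f n.+1) x).
Proof. by rewrite /= !chain_map_bd. Qed.

Definition chain_comp X Y Z (g : chain_map Y Z) (f : chain_map X Y) :
  chain_map X Z := ChainMap (chain_comp_bd g f).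

End ChainMaps.

Record cochain_complex := CochainComplex {
  cochain_obj :> nat -> zmodType;
  cobd : forall n, {additive cochain_obj n -> cochain_obj n.+1};
  cobd_cobd : forall n x, cobd n.+1 (cobd n x) = 0 }.

Record cochain_map (P Q : cochain_complex) := CochainMap {
  cochain_fun :> forall n, {additive P n -> Q n};
  cochain_map_cobd : forall n x,
    cochain_fun n.+1 (cobd P n x) = cobd Q n (cochain_fun n x) }.

(* [coshifted P Q] is the type of graded maps P -> Q[-1]; such a map vanishes
   on P^0, and its restriction to P^(n+1) is recorded at index n. *)
Definition coshifted (P Q : cochain_complex) : Type :=
  forall n, {additive P n.+1 -> Q n}.

Definition hd_dh (P Q : cochain_complex) (h : coshifted P Q) (n : nat) :
    P n -> Q n :=
  match n return P n -> Q n with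
  | 0 => fun x => h 0%N (cobd P 0 x)
  | m.+1 => fun x => h m.+1 (cobd P m.+1 x) + cobd Q m (h m x)
  end.

Definition cochain_homotopy (P Q : cochain_complex) (f g : cochain_map P Q)
    (h : coshifted P Q) : Prop :=
  forall n (x : P n), f n x - g n x = hd_dh h x.

Definition cochain_id (P : cochain_complex) : cochain_map P P :=
  @CochainMap P P (fun n => idfun) (fun _ _ => erefl).

(* The degree n part of the tensor product of two graded abelian groups is the
   direct sum of the A_p (x) B_q over the finitely many (p, q) with p + q = n;
   an element is the family of its components. *)
Section GradedTensor.
Variables A B : nat -> zmodType.

Definition gtens (n : nat) : Type :=
  forall p q : nat, (p + q)%N = n -> tensor (A p) (B q).

Section Zmodule.
Variable n : nat.
Implicit Types u v w : gtens n.

Lemma gtens_ext u v : (forall p q e, u p q e = v p q e) -> u = v.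
Proof.
by move=> uv; apply/functional_extensionality_dep => p;
   apply/functional_extensionality_dep => q;
   apply/functional_extensionality_dep => e; exact: uv.
Qed.

HB.instance Definition _ := gen_eqMixin (gtens n).
HB.instance Definition _ := gen_choiceMixin (gtens n).

Definition gtens_zero : gtens n := fun _ _ _ => 0.
Definition gtens_opp u : gtens n := fun p q e => - u p q e.
Definition gtens_add u v : gtens n := fun p q e => u p q e + v p q e.

Lemma gtens_addA : associative gtens_add.
Proof. by move=> u v w; apply: gtens_ext => p q e; apply: addrA. Qed.
Lemma gtens_addC : commutative gtens_add.
Proof. by move=> u v; apply: gtens_ext => p q e; apply: addrC. Qed.
Lemma gtens_add0 : left_id gtens_zero gtens_add.
Proof. by move=> u; apply: gtens_ext => p q e; apply: add0r. Qed.
Lemma gtens_addN : left_inverse gtens_zero gtens_opp gtens_add.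
Proof. by move=> u; apply: gtens_ext => p q e; apply: addNr. Qed.

HB.instance Definition _ := GRing.isZmodule.Build (gtens n)
  gtens_addA gtens_addC gtens_add0 gtens_addN.

Lemma gtensDE u v p q e : (u + v) p q e = u p q e + v p q e. Proof. by []. Qed.
Lemma gtensBE u v p q e : (u - v) p q e = u p q e - v p q e. Proof. by []. Qed.
Lemma gtens0E p q e : (0 : gtens n) p q e = 0. Proof. by []. Qed.

Definition gtens_comp p q e (u : gtens n) := u p q e.
Lemma gtens_comp_is_additive p q e : zmod_morphism (@gtens_comp p q e).
Proof. by []. Qed.
HB.instance Definition _ p q e := GRing.isZmodMorphism.Build (gtens n)
  (tensor (A p) (B q)) (@gtens_comp p q e) (@gtens_comp_is_additive p q e).

Lemma gtensMzE u k p q e : (u *~ k) p q e = u p q e *~ k.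
Proof. exact: (raddfMz (@gtens_comp p q e)). Qed.

Lemma gtens_sumE (I : Type) (r : seq I) (F : I -> gtens n) p q e :
  (\sum_(i <- r) F i) p q e = \sum_(i <- r) F i p q e.
Proof. exact: (raddf_sum (@gtens_comp p q e)). Qed.

Lemma gtens_irr u p q e e' : u p q e = u p q e'.
Proof. by rewrite (eq_irrelevance e e'). Qed.

End Zmodule.

(* The inclusion of the summand A_p (x) B_q. *)
Definition gincl p q n (e : (p + q)%N = n) (t : tensor (A p) (B q)) : gtens n :=
  fun p' q' _ =>
    match p =P p', q =P q' with
    | ReflectT ep, ReflectT eq =>
        ecast q'' (tensor (A p') (B q'')) eq (ecast p'' (tensor (A p'') (B q)) ep t)
    | _, _ => 0
    end.

(* The element a (x) b of degree n = p + q, for a in A_p and b in B_q. *)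
Definition gpure p q n (e : (p + q)%N = n) (a : A p) (b : B q) : gtens n :=
  gincl e (pure a b).

Lemma gincl_same p q n (e e' : (p + q)%N = n) t : gincl e t e' = t.
Proof.
rewrite /gincl; case: eqP => // ep; case: eqP => // eq.
by rewrite (eq_axiomK ep) (eq_axiomK eq).
Qed.

Lemma gincl_neq p q n (e : (p + q)%N = n) t p' q' (e' : (p' + q')%N = n) :
  p != p' -> gincl e t e' = 0.
Proof. by rewrite /gincl; case: eqP. Qed.

Lemma gincl_neqr p q n (e : (p + q)%N = n) t p' q' (e' : (p' + q')%N = n) :
  q != q' -> gincl e t e' = 0.
Proof.
move=> nq; apply: gincl_neq; apply: contraNneq nq => pp.
by rewrite -(eqn_add2l p) e pp e'.
Qed.

Lemma gincl_is_additive p q n (e : (p + q)%N = n) : zmod_morphism (gincl e).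
Proof.
move=> s t; apply: gtens_ext => p' q' e'; rewrite gtensBE.
have [ep|np] := eqVneq p p'; last by rewrite !gincl_neq // subr0.
case: p' / ep e' => e'; have eq : q = q' by apply: (@addnI p); rewrite e.
by case: q' / eq e' => e'; rewrite !gincl_same.
Qed.

HB.instance Definition _ p q n (e : (p + q)%N = n) :=
  GRing.isZmodMorphism.Build (tensor (A p) (B q)) (gtens n) (gincl e)
    (gincl_is_additive e).

Lemma gpure0l p q n (e : (p + q)%N = n) b : gpure e 0 b = 0.
Proof. by rewrite /gpure pure0l raddf0. Qed.

Lemma gpure0r p q n (e : (p + q)%N = n) a : gpure e a 0 = 0.
Proof. by rewrite /gpure !raddf0. Qed.

Lemma antidiag n (i : 'I_n.+1) : (i + (n - i))%N = n.
Proof. by rewrite subnKC // -ltnS. Qed.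

Lemma gtens_sum n (u : gtens n) :
  u = \sum_(i < n.+1) gincl (antidiag i) (u i (n - i)%N (antidiag i)).
Proof.
apply: gtens_ext => p q e; rewrite gtens_sumE.
have pn : (p < n.+1)%N by rewrite ltnS -e leq_addr.
rewrite (bigD1 (Ordinal pn)) //= big1 ?addr0 => [|i ip]; last first.
  by rewrite gincl_neq // -[p]/(nat_of_ord (Ordinal pn)) val_eqE.
move: (antidiag _) => /= e'; have eq : (n - p = q)%N by rewrite -e addKn.
by case: q / eq e => e; rewrite gincl_same; apply: gtens_irr.
Qed.

Lemma gtens_additive_ext (P : zmodType) n (f g : {additive gtens n -> P}) :
  (forall p q e a b, f (@gpure p q n e a b) = g (gpure e a b)) -> f =1 g.
Proof.
move=> fg u; rewrite [u]gtens_sum !raddf_sum; apply: eq_bigr => i _.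
by apply: (tensor_ext (f := f \o gincl _) (g := g \o gincl _)) => a b; exact: fg.
Qed.

(* The additive map induced by a family of biadditive maps on A_p x B_q. *)
Definition gtens_lift (P : zmodType) n
    (f : forall p q, (p + q)%N = n -> biadd (A p) (B q) P) (u : gtens n) : P :=
  \sum_(i < n.+1)
    tensor_lift (f i (n - i)%N (antidiag i)) (u i (n - i)%N (antidiag i)).

Section Lift.
Variables (P : zmodType) (n : nat).
Variable f : forall p q, (p + q)%N = n -> biadd (A p) (B q) P.

Lemma gtens_lift_is_additive : zmod_morphism (gtens_lift f).
Proof.
move=> u v; rewrite /gtens_lift -sumrB; apply: eq_bigr => i _.
by rewrite gtensBE raddfB.
Qed.

HB.instance Definition _ :=
  GRing.isZmodMorphism.Build (gtens n) P (gtens_lift f) gtens_lift_is_additive.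

Lemma gtens_lift_pure p q (e : (p + q)%N = n) a b :
  gtens_lift f (gpure e a b) = f e a b.
Proof.
have pn : (p < n.+1)%N by rewrite ltnS -e leq_addr.
rewrite /gtens_lift (bigD1 (Ordinal pn)) //= big1 ?addr0 => [|i ip]; last first.
  rewrite /gpure gincl_neq ?raddf0 // eq_sym.
  by rewrite -[X in _ != X]/(nat_of_ord (Ordinal pn)) val_eqE.
move: (antidiag _) => /= e'; have eq : (q = n - p)%N by rewrite -e addKn.
case: _ / eq e' => e'; rewrite (eq_irrelevance e' e) /gpure gincl_same.
exact: tensor_lift_pure.
Qed.

End Lift.
End GradedTensor.

Section GradedTensorGModule.
Variables (G : groupType) (A B : nat -> gmodType G).

Definition ggtens (n : nat) : Type := gtens (fun p => A p) (fun q => B q) n.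

Section Fix.
Variable n : nat.

HB.instance Definition _ := GRing.Zmodule.on (ggtens n).

Definition ggtens_act (s : G) (u : ggtens n) : ggtens n :=
  fun p q e => gact s (u p q e : tensor (A p) (B q)).

Lemma ggtens_act1 u : ggtens_act 1%g u = u.
Proof. by apply: gtens_ext => p q e; apply: gact1. Qed.
Lemma ggtens_actM s t u : ggtens_act (s * t)%g u = ggtens_act s (ggtens_act t u).
Proof. by apply: gtens_ext => p q e; apply: gactM. Qed.
Lemma ggtens_actD s : {morph ggtens_act s : u v / u + v}.
Proof. by move=> u v; apply: gtens_ext => p q e; apply: gactD. Qed.

HB.instance Definition _ := isGModule.Build G (ggtens n)
  ggtens_act1 ggtens_actM ggtens_actD.

Definition ggpure p q (e : (p + q)%N = n) (a : A p) (b : B q) : ggtens n :=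
  gpure (A := fun p => A p) (B := fun q => B q) e a b.

End Fix.
End GradedTensorGModule.

(* bd (x (x) y) = bd x (x) y + (-1)^(deg x) x (x) bd y: the (p, q) component of
   bd u comes from the (p + 1, q) and (p, q + 1) components of u. *)
Section TensorComplex.
Variables (G : groupType) (X Y : chain_complex G).

Lemma addSn_eq p q n : (p + q)%N = n -> (p.+1 + q)%N = n.+1.
Proof. by move=> <-. Qed.
Lemma addnS_eq p q n : (p + q)%N = n -> (p + q.+1)%N = n.+1.
Proof. by move=> <-; rewrite addnS. Qed.

Section Fix.
Variable n : nat.

Definition tens_bd_fun (u : ggtens X Y n.+1) : ggtens X Y n := fun p q e =>
  tensor_map (bd X p) idfun (u p.+1 q (addSn_eq e))
  + tensor_map idfun (bd Y q) (u p q.+1 (addnS_eq e)) *~ (-1) ^+ p.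

Lemma tens_bd_is_additive : zmod_morphism tens_bd_fun.
Proof.
move=> u v; apply: gtens_ext => p q e; rewrite /tens_bd_fun !gtensBE.
by rewrite !raddfB /= mulrzBl opprD addrACA.
Qed.

HB.instance Definition _ := GRing.isZmodMorphism.Build
  (ggtens X Y n.+1) (ggtens X Y n) tens_bd_fun tens_bd_is_additive.

Lemma tens_bdJ (s : G) u : tens_bd_fun (gact s u) = gact s (tens_bd_fun u).
Proof.
apply: gtens_ext => p q e; rewrite /tens_bd_fun.
rewrite -[RHS]/(gact s (_ + _)) gactD raddf_sgn.
by congr (_ + _ *~ _); [exact: (tensor_mapJ (bd X p) (ghom_id _))
                       | exact: (tensor_mapJ (ghom_id _) (bd Y q))].
Qed.

Definition tens_bd : ghom (ggtens X Y n.+1) (ggtens X Y n) := GHom tens_bdJ.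

End Fix.

Section Pure.
Variables (p q n : nat).

Lemma tens_bdl_pure (e : (p.+1 + q)%N = n.+1) (f : (p + q)%N = n)
    (x : X p.+1) (y : Y q) p' q' (f' : (p' + q')%N = n) :
  tensor_map (bd X p') idfun (ggpure (A := X) (B := Y) e x y (addSn_eq f')) =
  ggpure (A := X) (B := Y) f (bd X p x) y f'.
Proof.
rewrite /ggpure /gpure; have [ep|np] := eqVneq p p'; last first.
  by rewrite !gincl_neq ?eqSS // raddf0.
case: p' / ep f' => f'; have eq : q = q' by apply: (@addnI p); rewrite f' f.
by case: q' / eq f' => f'; rewrite !gincl_same tensor_map_pure.
Qed.

Lemma tens_bdr_pure (e : (p + q.+1)%N = n.+1) (f : (p + q)%N = n)
    (x : X p) (y : Y q.+1) p' q' (f' : (p' + q')%N = n) :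
  tensor_map idfun (bd Y q') (ggpure (A := X) (B := Y) e x y (addnS_eq f'))
    *~ (-1) ^+ p' =
  (ggpure (A := X) (B := Y) f x (bd Y q y) *~ (-1) ^+ p) p' q' f'.
Proof.
rewrite gtensMzE /ggpure /gpure; have [ep|np] := eqVneq p p'; last first.
  by rewrite !gincl_neq // raddf0 !mul0rz.
case: p' / ep f' => f'; have eq : q = q' by apply: (@addnI p); rewrite f' f.
by case: q' / eq f' => f'; rewrite !gincl_same tensor_map_pure.
Qed.

End Pure.

Lemma tens_bd_pure p q n (e : (p.+1 + q.+1)%N = n.+1)
    (el : (p + q.+1)%N = n) (er : (p.+1 + q)%N = n)
    (x : X p.+1) (y : Y q.+1) :
  tens_bd n (ggpure (A := X) (B := Y) e x y) =
  ggpure (A := X) (B := Y) el (bd X p x) y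
  + ggpure (A := X) (B := Y) er x (bd Y q y) *~ (-1) ^+ p.+1.
Proof.
apply: gtens_ext => p' q' f; rewrite gtensDE -tens_bdr_pure /= /tens_bd_fun.
by rewrite (tens_bdl_pure _ el).
Qed.

Lemma tens_bd_pure0l q n (e : (0 + q.+1)%N = n.+1) (er : (0 + q)%N = n)
    (x : X 0%N) (y : Y q.+1) :
  tens_bd n (ggpure (A := X) (B := Y) e x y) =
  ggpure (A := X) (B := Y) er x (bd Y q y).
Proof.
apply: gtens_ext => p' q' f; rewrite /= /tens_bd_fun.
rewrite (tens_bdr_pure _ er) expr0 mulr1z.
by rewrite /ggpure /gpure gincl_neq // raddf0 add0r.
Qed.

Lemma tens_bd_pure0r p n (e : (p.+1 + 0)%N = n.+1) (el : (p + 0)%N = n)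
    (x : X p.+1) (y : Y 0%N) :
  tens_bd n (ggpure (A := X) (B := Y) e x y) =
  ggpure (A := X) (B := Y) el (bd X p x) y.
Proof.
apply: gtens_ext => p' q' f; rewrite /= /tens_bd_fun (tens_bdl_pure _ el).
by rewrite /ggpure /gpure (gincl_neqr _ _ (addnS_eq f)) // raddf0 mul0rz addr0.
Qed.

Lemma tens_bd_bd n u : tens_bd n (tens_bd n.+1 u) = 0.
Proof.
apply: gtens_ext => p q e; rewrite gtens0E /= /tens_bd_fun.
rewrite !raddfD !raddf_sgn /= !tensor_map_comp.
have z0 (M N M' N' : zmodType) (f : {additive M -> M'}) (g : {additive N -> N'}) t :
    (f =1 fun=> 0) \/ (g =1 fun=> 0) -> tensor_map f g t = 0.
  move=> fg0; apply: (tensor_ext (f := tensor_map f g) (g := \0)) => a b /=.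
  by rewrite tensor_map_pure; case: fg0 => ->; rewrite ?pure0l ?raddf0.
rewrite z0 ?add0r; last by left=> x /=; exact: bd_bd.
rewrite [X in _ + (_ + X *~ _) *~ _]z0; last by right=> x /=; exact: bd_bd.
rewrite mul0rz addr0 exprS mulN1r mulrNz.
rewrite (gtens_irr _ (addnS_eq (addSn_eq e)) (addSn_eq (addnS_eq e))).
by rewrite (additive_ext (f := _ \o idfun) (g := idfun \o (bd X p))) // addNr.
Qed.

Definition tens_complex : chain_complex G :=
  @ChainComplex G (fun n => ggtens X Y n) tens_bd tens_bd_bd.

End TensorComplex.

(* d (a (x) b) = d a (x) b + (-1)^(deg a) a (x) d b, in components. *)
Section CoTensorComplex.
Variables P Q : cochain_complex.
Local Notation PQ := (gtens P Q).

Lemma addSn_inj p q n : (p.+1 + q)%N = n.+1 -> (p + q)%N = n.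
Proof. by case. Qed.
Lemma addnS_inj p q n : (p + q.+1)%N = n.+1 -> (p + q)%N = n.
Proof. by rewrite addnS => -[]. Qed.

Definition cotens_cobdl n (u : PQ n) p q :
    (p + q)%N = n.+1 -> tensor (P p) (Q q) :=
  match p return (p + q)%N = n.+1 -> tensor (P p) (Q q) with
  | 0 => fun _ => 0
  | p'.+1 => fun e => tensor_map (cobd P p') idfun (u p' q (addSn_inj e))
  end.

Definition cotens_cobdr n (u : PQ n) p q :
    (p + q)%N = n.+1 -> tensor (P p) (Q q) :=
  match q return (p + q)%N = n.+1 -> tensor (P p) (Q q) with
  | 0 => fun _ => 0
  | q'.+1 => fun e =>
      tensor_map idfun (cobd Q q') (u p q' (addnS_inj e)) *~ (-1) ^+ p
  end.

Definition cotens_cobd n (u : PQ n) : PQ n.+1 :=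
  fun p q e => cotens_cobdl u e + cotens_cobdr u e.

Lemma cotens_cobd_is_additive n : zmod_morphism (@cotens_cobd n).
Proof.
move=> u v; apply: gtens_ext => p q e; rewrite gtensBE /cotens_cobd.
have -> : cotens_cobdl (u - v) e = cotens_cobdl u e - cotens_cobdl v e.
  by case: p e => [|p] e /=; rewrite ?subr0 // gtensBE raddfB.
have -> : cotens_cobdr (u - v) e = cotens_cobdr u e - cotens_cobdr v e.
  by case: q e => [|q] e /=; rewrite ?subr0 // gtensBE raddfB /= mulrzBl.
by rewrite opprD addrACA.
Qed.

HB.instance Definition _ n := GRing.isZmodMorphism.Build (PQ n) (PQ n.+1)
  (@cotens_cobd n) (@cotens_cobd_is_additive n).

Lemma cotens_cobd_pure p q n (e : (p + q)%N = n) (a : P p) (b : Q q) :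
  cotens_cobd (gpure (B := Q) e a b) =
  gpure (B := Q) (addSn_eq e) (cobd P p a) b
  + gpure (A := P) (addnS_eq e) a (cobd Q q b) *~ (-1) ^+ p.
Proof.
apply: gtens_ext => p' q' e'; rewrite gtensDE gtensMzE /cotens_cobd.
congr (_ + _).
  have [ep|np] := eqVneq p.+1 p'.
    case: p' / ep e' => e' /=; have eq : q = q' by apply: (@addnI p.+1); rewrite e' -e.
    by case: q' / eq e' => e'; rewrite /gpure !gincl_same tensor_map_pure.
  rewrite /gpure gincl_neq //.
  by case: p' np e' => [|p'] np e' //=; rewrite gincl_neq // raddf0.
have [ep|np] := eqVneq p p'.
  case: p' / ep e' => e' /=; have eq : q.+1 = q' by apply: (@addnI p); rewrite e' -e addnS.
  by case: q' / eq e' => e'; rewrite /gpure /= !gincl_same tensor_map_pure.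
rewrite /gpure gincl_neq // mul0rz.
by case: q' e' => [|q'] e' //=; rewrite gincl_neq // raddf0 mul0rz.
Qed.

Lemma cotens_cobd_cobd n (u : PQ n) : cotens_cobd (cotens_cobd u) = 0.
Proof.
apply: (gtens_additive_ext (f := @cotens_cobd n.+1 \o @cotens_cobd n) (g := \0)).
move=> p q e a b /=; rewrite cotens_cobd_pure raddfD raddf_sgn /=.
rewrite !cotens_cobd_pure !cobd_cobd.
rewrite gpure0l gpure0r mul0rz addr0 add0r exprS mulN1r mulrNz.
have -> : addnS_eq (addSn_eq e) = addSn_eq (addnS_eq e) by exact: eq_irrelevance.
by rewrite addNr.
Qed.

Definition cotens_complex : cochain_complex :=
  @CochainComplex PQ (fun n => @cotens_cobd n) cotens_cobd_cobd.

End CoTensorComplex.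

Section StandardModule.
Variable G : groupType.

Definition std (n : nat) : Type := {freeg {ffun 'I_n.+1 -> G}}.

Section Fix.
Variable n : nat.
Local Notation simplex := {ffun 'I_n.+1 -> G}.

HB.instance Definition _ := GRing.Zmodule.on (std n).

Definition simplex_act (u : G) (s : simplex) : simplex := [ffun i => (u * s i)%g].

Definition std_act (u : G) : std n -> std n :=
  free_lift (fun s => fgen (simplex_act u s)).

HB.instance Definition _ u := GRing.Additive.on (std_act u).

Lemma std_act1 x : std_act 1%g x = x.
Proof.
apply: (free_ext (f := std_act 1%g) (g := idfun)) => s /=.
by rewrite /std_act free_lift_gen; congr fgen; apply/ffunP => i; rewrite ffunE mul1g.
Qed.
Lemma std_actM s t x : std_act (s * t)%g x = std_act s (std_act t x).
Proof.
apply: (free_ext (f := std_act _) (g := std_act s \o std_act t)) => r /=.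
rewrite /std_act !free_lift_gen; congr fgen; apply/ffunP => i.
by rewrite !ffunE mulgA.
Qed.
Lemma std_actD s : {morph std_act s : x y / x + y}.
Proof. exact: raddfD. Qed.

HB.instance Definition _ := isGModule.Build G (std n) std_act1 std_actM std_actD.

Definition sgen (s : simplex) : std n := fgen s.

Lemma gact_sgen (u : G) s : gact u (sgen s) = sgen (simplex_act u s).
Proof. exact: free_lift_gen. Qed.

Lemma std_ext (M : zmodType) (f g : {additive std n -> M}) :
  (forall s, f (sgen s) = g (sgen s)) -> f =1 g.
Proof. exact: free_ext. Qed.

Section Lift.
Variables (M : zmodType) (f : simplex -> M).

Definition std_lift : std n -> M := free_lift f.
HB.instance Definition _ := GRing.Additive.on std_lift.

Lemma std_lift_gen s : std_lift (sgen s) = f s.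
Proof. exact: free_lift_gen. Qed.
End Lift.

(* The G-linear extension of a G-equivariant map on G^(n+1). *)
Section GLift.
Variables (M : gmodType G) (f : simplex -> M).
Hypothesis fJ : forall u s, f (simplex_act u s) = gact u (f s).

Lemma std_liftJ (u : G) x : std_lift f (gact u x) = gact u (std_lift f x).
Proof.
apply: (std_ext (f := std_lift f \o gact u) (g := gact u \o std_lift f)) => s /=.
by rewrite gact_sgen !std_lift_gen fJ.
Qed.

Definition std_glift : ghom (std n) M := GHom std_liftJ.

Lemma std_glift_gen s : std_glift (sgen s) = f s.
Proof. exact: std_lift_gen. Qed.
End GLift.

End Fix.
End StandardModule.

(* A double alternating sum whose terms cancel in pairs. *)
Lemma alt_sum_cancel (V : zmodType) N (F : nat -> nat -> V) :
  (forall i j, (j <= i)%N -> (i < N)%N -> F i.+1 j = F j i) ->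
  \sum_(i < N.+1) \sum_(j < N) F i j *~ (-1) ^+ (i + j) = 0.
Proof.
move=> FE.
rewrite (eq_bigr (fun i : 'I_N.+1 =>
   \sum_(j < N | (j < i)%N) F i j *~ (-1) ^+ (i + j)
   + \sum_(j < N | ~~ (j < i)%N) F i j *~ (-1) ^+ (i + j))); last first.
  by move=> i _; rewrite (bigID (fun j : 'I_N => (j < i)%N)).
rewrite big_split /= big_ord_recl big1 // add0r.
rewrite [X in _ + X]big_ord_recr /= [X in _ + (_ + X)]big1 ?addr0; last first.
  by move=> j; rewrite ltn_ord.
rewrite (exchange_big_dep predT) //= -big_split /= big1 // => j _.
rewrite [X in X + _](eq_bigl (fun i : 'I_N => ~~ (i < j)%N)); last first.
  by move=> i; rewrite /bump /= add1n ltnS -leqNgt.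
rewrite -big_split big1 //= => i; rewrite -leqNgt => ji.
rewrite /bump /= add1n FE // -[(i.+1 + j)%N]/((i + j).+1) exprS mulN1r mulrNz.
by rewrite addnC addNr.
Qed.

Lemma AW_split (V : zmodType) p q (g a b : nat -> V) :
  (forall i, (i <= p)%N -> g i = a i) ->
  (forall j, (j <= q)%N -> g (p.+1 + j)%N = b j.+1) ->
  a p.+1 + b 0%N = 0 ->
  \sum_(i < (p + q).+2) g i = \sum_(i < p.+2) a i + \sum_(j < q.+2) b j.
Proof.
move=> ga gb ab; have -> : (p + q).+2 = (p.+1 + q.+1)%N by rewrite addnS.
rewrite big_split_ord /= [X in _ = X + _]big_ord_recr [X in _ = _ + X]big_ord_recl /=.
rewrite -addrA [X in _ = _ + X]addrA ab add0r; congr (_ + _).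
  by apply: eq_bigr => i _; rewrite ga // -ltnS.
by apply: eq_bigr => j _; rewrite gb // -ltnS.
Qed.

Section StandardResolution.
Variable G : groupType.

Definition face n (i : 'I_n.+2) (s : {ffun 'I_n.+2 -> G}) :
  {ffun 'I_n.+1 -> G} := [ffun j => s (fintype.lift i j)].

Definition std_bd_fun n (s : {ffun 'I_n.+2 -> G}) : std G n :=
  \sum_(i < n.+2) sgen (face i s) *~ (-1) ^+ i.

Lemma std_bd_funJ n u (s : {ffun 'I_n.+2 -> G}) :
  std_bd_fun (simplex_act u s) = gact u (std_bd_fun s).
Proof.
rewrite /std_bd_fun raddf_sum; apply: eq_bigr => i _.
rewrite raddf_sgn /= gact_sgen; congr (sgen _ *~ _).
by apply/ffunP => j; rewrite !ffunE.
Qed.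

Definition std_bd n : ghom (std G n.+1) (std G n) :=
  std_glift (@std_bd_funJ n).

(* [faceN i] is [face] with the omitted position given as a number. *)
Definition faceN n (i : nat) (s : {ffun 'I_n.+2 -> G}) : {ffun 'I_n.+1 -> G} :=
  [ffun j : 'I_n.+1 => s (inord (bump i j))].

Lemma std_bd_funE n (s : {ffun 'I_n.+2 -> G}) :
  std_bd_fun s = \sum_(i < n.+2) sgen (faceN i s) *~ (-1) ^+ i.
Proof.
apply: eq_bigr => i _; congr (sgen _ *~ _); apply/ffunP => j; rewrite !ffunE.
by congr (s _); apply: val_inj; rewrite /= inordK //; exact: (ltn_ord (fintype.lift i j)).
Qed.

Lemma std_bd_bd n x : std_bd n (std_bd n.+1 x) = 0.
Proof.
apply: (std_ext (f := std_bd n \o std_bd n.+1) (g := \0)) => s /=.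
rewrite !std_lift_gen std_bd_funE raddf_sum /=.
under eq_bigr => i _.
  rewrite raddf_sgn /= std_lift_gen std_bd_funE mulrz_suml.
  under eq_bigr => j _ do rewrite -mulrzA -exprD [(j + i)%N]addnC.
  over.
apply: (@alt_sum_cancel _ n.+2 (fun i j => sgen (faceN j (faceN i s)))).
move=> i j ji iN; congr sgen; apply/ffunP => k; rewrite !ffunE.
have bump_lt m h (l : 'I_m.+1) : (bump h l < m.+2)%N.
  by rewrite /bump; case: (h <= l)%N; rewrite ?add1n ?add0n ltnS // ltnW.
congr (s _); apply: val_inj; rewrite /= !inordK //.
- by rewrite /bump; lia.
- by move: (ltn_ord k); rewrite /bump; lia.
- by move: (ltn_ord k); rewrite /bump; lia.
Qed.

Definition std_complex : chain_complex G :=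
  @ChainComplex G (fun n => std G n) std_bd std_bd_bd.

(* Right translation tau_s. *)
Definition simplex_tr n (s : G) (r : {ffun 'I_n.+1 -> G}) :
  {ffun 'I_n.+1 -> G} := [ffun i => (r i * s)%g].

Definition tr_fun n (s : G) (r : {ffun 'I_n.+1 -> G}) : std G n :=
  sgen (simplex_tr s r).

Lemma tr_funJ n s u (r : {ffun 'I_n.+1 -> G}) :
  tr_fun s (simplex_act u r) = gact u (tr_fun s r).
Proof.
by rewrite gact_sgen; congr sgen; apply/ffunP => i; rewrite !ffunE mulgA.
Qed.

Definition tr_ghom s n : ghom (std_complex n) (std_complex n) :=
  std_glift (@tr_funJ n s).

Lemma tr_bd s n x :
  tr_ghom s n (bd std_complex n x) = bd std_complex n (tr_ghom s n.+1 x).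
Proof.
apply: (std_ext (f := tr_ghom s n \o std_bd n)
                (g := std_bd n \o tr_ghom s n.+1)) => r /=.
rewrite !std_lift_gen raddf_sum; apply: eq_bigr => i _.
rewrite raddf_sgn /= std_lift_gen; congr (sgen _ *~ _).
by apply/ffunP => j; rewrite !ffunE.
Qed.

Definition tau_tr (s : G) : chain_map std_complex std_complex :=
  ChainMap (tr_bd s).

(* The front face (s_0, ..., s_p) and the back face (s_p, ..., s_n) of
   (s_0, ..., s_n), where n = p + q. *)
Definition front p n (s : {ffun 'I_n.+1 -> G}) : {ffun 'I_p.+1 -> G} :=
  [ffun i : 'I_p.+1 => s (inord i)].

Definition back p q n (s : {ffun 'I_n.+1 -> G}) : {ffun 'I_q.+1 -> G} :=
  [ffun i : 'I_q.+1 => s (inord (p + i))].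

Local Notation F := std_complex.
Local Notation FF := (tens_complex std_complex std_complex).

Definition AW_fun n (s : {ffun 'I_n.+1 -> G}) : FF n :=
  fun p q _ => pure (sgen (front p s)) (sgen (back p q s)).

Lemma AW_funJ n u (s : {ffun 'I_n.+1 -> G}) :
  AW_fun (simplex_act u s) = gact u (AW_fun s).
Proof.
apply: gtens_ext => p q e.
rewrite -[RHS]/(tensor_map (gact u) (gact u) (AW_fun s e)).
rewrite /AW_fun tensor_map_pure /= !gact_sgen.
by congr (pure (sgen _) (sgen _)); apply/ffunP => i; rewrite !ffunE.
Qed.

Definition AW_ghom n : ghom (F n) (FF n) := std_glift (@AW_funJ n).

(* The usual form of the Alexander-Whitney map. *)
Lemma AW_sum n (s : {ffun 'I_n.+1 -> G}) :
  AW_ghom n (sgen s) =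
  \sum_(i < n.+1) ggpure (A := F) (B := F) (antidiag i)
    (sgen (front i s)) (sgen (back i (n - i) s)).
Proof. by rewrite [LHS]std_glift_gen [LHS]gtens_sum. Qed.

Lemma AW_bd n x : AW_ghom n (bd F n x) = bd FF n (AW_ghom n.+1 x).
Proof.
apply: (std_ext (f := AW_ghom n \o std_bd n)
                (g := bd FF n \o AW_ghom n.+1)) => s.
rewrite [LHS]/= [RHS]/= !std_lift_gen.
apply: gtens_ext => p q e; rewrite /tens_bd_fun.
rewrite std_bd_funE raddf_sum gtens_sumE.
under eq_bigr => i _ do rewrite raddf_sgn gtensMzE /= std_lift_gen.
rewrite /AW_fun !tensor_map_pure /= !std_lift_gen !std_bd_funE.
rewrite pure_suml raddf_sum /=.
under [X in X + _]eq_bigr => i _ do rewrite pureMzl.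
under [X in _ + X *~ _]eq_bigr => i _ do rewrite raddf_sgn /=.
rewrite mulrz_suml; subst n.
apply: (@AW_split _ p q
  (fun i => pure (sgen (front p (faceN i s))) (sgen (back p q (faceN i s)))
     *~ (-1) ^+ i)
  (fun i => pure (sgen (faceN i (front p.+1 s))) (sgen (back p.+1 q s))
     *~ (-1) ^+ i)
  (fun i => pure (sgen (front p s)) (sgen (faceN i (back p q.+1 s)))
     *~ (-1) ^+ i *~ (-1) ^+ p)).
- move=> i ip; congr (pure (sgen _) (sgen _) *~ _).
    apply/ffunP => k; rewrite !ffunE; move: (ltn_ord k) => kp.
    by congr (s _); apply: val_inj; rewrite /= !inordK // /bump; lia.
  apply/ffunP => k; rewrite !ffunE; move: (ltn_ord k) => kp.
  by congr (s _); apply: val_inj; rewrite /= !inordK // /bump; lia.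
- move=> j jq; rewrite -mulrzA -exprD.
  congr (pure (sgen _) (sgen _) *~ (-1) ^+ _); last by lia.
    apply/ffunP => k; rewrite !ffunE; move: (ltn_ord k) => kp.
    by congr (s _); apply: val_inj; rewrite /= !inordK // /bump; lia.
  apply/ffunP => k; rewrite !ffunE; move: (ltn_ord k) => kp.
  by congr (s _); apply: val_inj; rewrite /= !inordK // /bump; lia.
- rewrite expr0 mulr1z exprS mulN1r mulrNz addrC; apply/eqP; rewrite subr_eq0.
  apply/eqP; congr (pure (sgen _) (sgen _) *~ _).
    apply/ffunP => k; rewrite !ffunE; move: (ltn_ord k) => kp.
    by congr (s _); apply: val_inj; rewrite /= !inordK // /bump; lia.
  apply/ffunP => k; rewrite !ffunE; move: (ltn_ord k) => kp.
  by congr (s _); apply: val_inj; rewrite /= !inordK // /bump; lia.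
Qed.

Definition AW : chain_map F FF := ChainMap AW_bd.

End StandardResolution.

(* tau (x (x) y) = (-1)^(deg x deg y) y (x) x. *)
Section TensorSwap.
Variables (G : groupType) (X Y : chain_complex G).
Local Notation XY := (tens_complex X Y).
Local Notation YX := (tens_complex Y X).

Lemma addC_eq p q n : (p + q)%N = n -> (q + p)%N = n.
Proof. by rewrite addnC. Qed.

Definition tau_fun n (u : XY n) : YX n := fun p q e =>
  tensor_swap (u q p (addC_eq e)) *~ (-1) ^+ (p * q).

Lemma tau_is_additive n : zmod_morphism (@tau_fun n).
Proof.
move=> u v; apply: gtens_ext => p q e.
by rewrite gtensBE /tau_fun gtensBE raddfB mulrzBl.
Qed.

HB.instance Definition _ n := GRing.isZmodMorphism.Build (XY n) (YX n)
  (@tau_fun n) (@tau_is_additive n).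

Lemma tau_funJ n (s : G) u : @tau_fun n (gact s u) = gact s (tau_fun u).
Proof.
apply: gtens_ext => p q e; rewrite /tau_fun.
rewrite -[RHS]/(gact s (_ *~ _)) raddf_sgn; congr (_ *~ _).
exact: tensor_swapJ.
Qed.

Definition tau_ghom n : ghom (XY n) (YX n) := GHom (@tau_funJ n).

Lemma tensor_swap_map (M N M' N' : zmodType) (f : {additive M -> M'})
    (g : {additive N -> N'}) t :
  tensor_swap (tensor_map f g t) = tensor_map g f (tensor_swap t).
Proof.
apply: (tensor_ext (f := @tensor_swap _ _ \o tensor_map f g)
                   (g := tensor_map g f \o @tensor_swap _ _)) => m n /=.
by rewrite tensor_map_pure !tensor_swap_pure tensor_map_pure.
Qed.

Lemma sgn_congr (V : zmodType) (x : V) k l :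
  odd k = odd l -> x *~ (-1) ^+ k = x *~ (-1) ^+ l.
Proof. by move=> kl; rewrite -signr_odd kl signr_odd. Qed.

Lemma tau_bd n u : tau_ghom n (bd XY n u) = bd YX n (tau_ghom n.+1 u).
Proof.
apply: gtens_ext => p q e; rewrite /= /tens_bd_fun /tau_fun /tens_bd_fun.
rewrite raddfD !raddf_sgn /= mulrzDl -!mulrzA -!exprD !tensor_swap_map addrC.
rewrite (gtens_irr _ (addnS_eq (addC_eq e)) (addC_eq (addSn_eq e))).
rewrite (gtens_irr _ (addSn_eq (addC_eq e)) (addC_eq (addnS_eq e))).
by congr (_ + _); apply: sgn_congr; rewrite !(oddD, oddM) /=;
   case: (odd p); case: (odd q).
Qed.

Definition tau : chain_map XY YX := ChainMap tau_bd.

Lemma tau_pure p q n (e : (p + q)%N = n) (x : X p) (y : Y q) :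
  tau n (ggpure (A := X) (B := Y) e x y) =
  ggpure (A := Y) (B := X) (addC_eq e) y x *~ (-1) ^+ (p * q).
Proof.
apply: gtens_ext => p' q' e'; rewrite gtensMzE /= /tau_fun /ggpure /gpure.
have [ep|np] := eqVneq q p'; last first.
  by rewrite gincl_neqr // [in RHS]gincl_neq // raddf0 !mul0rz.
case: p' / ep e' => e'; have eq : p = q' by apply: (@addnI q); rewrite e' addnC.
by case: q' / eq e' => e'; rewrite !gincl_same tensor_swap_pure mulnC.
Qed.

End TensorSwap.

Section HomComplex.
Variables (G : groupType) (X : chain_complex G) (M : gmodType G).

Definition hom_cobd n : {additive ghom (X n) M -> ghom (X n.+1) M} :=
  precomp (bd X n).

Lemma hom_cobd_cobd n a : hom_cobd n.+1 (hom_cobd n a) = 0.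
Proof. by apply: ghom_ext => x /=; rewrite bd_bd raddf0. Qed.

Definition hom_complex : cochain_complex :=
  @CochainComplex (fun n => ghom (X n) M) hom_cobd hom_cobd_cobd.

End HomComplex.

(* C(G, M) = Hom_G(F, M). *)
Definition coch (G : groupType) (M : gmodType G) : cochain_complex :=
  hom_complex (std_complex G) M.

(* (s a)(s_0, ..., s_n) = s a(s^-1 s_0 s, ..., s^-1 s_n s). *)
Section CochainAction.
Variables (G : groupType) (M : gmodType G) (s : G).

Definition std_conj n : std G n -> std G n :=
  std_lift (fun r => sgen [ffun i => (s^-1 * r i * s)%g]).
HB.instance Definition _ n := GRing.Additive.on (@std_conj n).

Lemma coch_actJ n (a : coch M n) (u : G) x :
  (gact s \o (a \o @std_conj n)) (gact u x) =
  gact u ((gact s \o (a \o @std_conj n)) x).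
Proof.
pose f : {additive std G n -> M} := gact s \o (a \o (@std_conj n \o gact u)).
pose g : {additive std G n -> M} := gact u \o (gact s \o (a \o @std_conj n)).
apply: (std_ext (f := f) (g := g)) => r; rewrite /f /g /=.
rewrite gact_sgen /std_conj !std_lift_gen -!gactM.
set r1 := finfun _; set r2 := finfun _.
have -> : sgen r1 = gact (s^-1 * (u * s))%g (sgen r2).
  rewrite gact_sgen; congr sgen; apply/ffunP => i.
  by rewrite !ffunE !mulgA mulgK.
by rewrite ghomJ -!gactM !mulgA mulgV mul1g.
Qed.

Definition coch_act_fun n (a : coch M n) : coch M n := GHom (@coch_actJ n a).

Lemma coch_act_is_additive n : zmod_morphism (@coch_act_fun n).
Proof. by move=> a b; apply: ghom_ext => x /=; rewrite raddfB. Qed.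

HB.instance Definition _ n := GRing.isZmodMorphism.Build (coch M n) (coch M n)
  (@coch_act_fun n) (@coch_act_is_additive n).

(* (s a)(s_0, ..., s_n) = a(s_0 s, ..., s_n s). *)
Lemma coch_actE n (a : coch M n) x : coch_act_fun a x = a (tau_tr s n x).
Proof.
apply: (std_ext (f := coch_act_fun a) (g := a \o tau_tr s n)) => r /=.
rewrite /std_conj !std_lift_gen -ghomJ gact_sgen; congr (a (sgen _)).
by apply/ffunP => i; rewrite !ffunE !mulgA mulgV mul1g.
Qed.

Lemma coch_act_cobd n (a : coch M n) :
  coch_act_fun (cobd (coch M) n a) = cobd (coch M) n (coch_act_fun a).
Proof.
apply: ghom_ext => x; rewrite coch_actE /= -[RHS]/(coch_act_fun a _) coch_actE.
by congr (a _); apply/esym/(chain_map_bd (tau_tr s)).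
Qed.

Definition coch_act : cochain_map (coch M) (coch M) :=
  @CochainMap (coch M) (coch M) (fun n => @coch_act_fun n) coch_act_cobd.

End CochainAction.

Section Products.
Variables (G : groupType) (M N : gmodType G).
Local Notation F := (std_complex G).
Local Notation FF := (tens_complex F F).

Section Cross.
Variables (p q n : nat) (e : (p + q)%N = n).

Definition FF_comp (u : FF n) : tensor (F p) (F q) := u p q e.
Lemma FF_comp_is_additive : zmod_morphism FF_comp.
Proof. by []. Qed.
HB.instance Definition _ := GRing.isZmodMorphism.Build
  (FF n) (tensor (F p) (F q)) FF_comp FF_comp_is_additive.

Lemma crossJ (a : coch M p) (b : coch N q) (s : G) u :
  (tensor_map a b \o FF_comp) (gact s u) =
  gact s ((tensor_map a b \o FF_comp) u).
Proof. exact: tensor_mapJ. Qed.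

(* a x b, on the degree n = p + q part of F (x) F; it vanishes on the summands
   other than F_p (x) F_q. *)
Definition cross (a : coch M p) (b : coch N q) : ghom (FF n) (tensor M N) :=
  GHom (crossJ a b).

Lemma crossDl b : {morph cross^~ b : a a' / a + a'}.
Proof. by move=> a a'; apply: ghom_ext => u; apply: tensor_mapDl. Qed.
Lemma crossDr a : {morph cross a : b b' / b + b'}.
Proof. by move=> b b'; apply: ghom_ext => u; apply: tensor_mapDr. Qed.

Definition cross_biadd : biadd (coch M p) (coch N q) (ghom (FF n) (tensor M N)) :=
  Biadd crossDl crossDr.

End Cross.
End Products.

Section Cup.
Variables (G : groupType) (M N : gmodType G).

(* a cup b = (a x b) Delta. *)
Definition cup p q n (e : (p + q)%N = n) (a : coch M p) (b : coch N q) :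
  coch (tensor M N) n := ghom_comp (cross e a b) (AW G n).

Definition cup_biadd p q n (e : (p + q)%N = n) :
    biadd (coch M p) (coch N q) (coch (tensor M N) n) :=
  Biadd (biadd_fun := cup e)
    (biadd_compDl (cross_biadd M N e) (precomp (AW G n)) idfun idfun)
    (biadd_compDr (cross_biadd M N e) (precomp (AW G n)) idfun idfun).

Lemma cobd_cup p q n (e : (p + q)%N = n) (a : coch M p) (b : coch N q) :
  cobd (coch (tensor M N)) n (cup e a b) =
  cup (addSn_eq e) (cobd (coch M) p a) b
  + cup (addnS_eq e) a (cobd (coch N) q b) *~ (-1) ^+ p.
Proof.
apply: ghom_ext => x; rewrite ghomDE ghomMzE.
rewrite -[LHS]/(cross e a b (AW G n (bd (std_complex G) n x))) chain_map_bd.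
rewrite -[LHS]/(tensor_map a b (_ + _ *~ _)) raddfD raddf_sgn /=.
by rewrite !tensor_map_comp.
Qed.

Definition tensor_coch : cochain_complex := cotens_complex (coch M) (coch N).

Lemma cup_map_cobd n x :
  gtens_lift (fun p q e => cup_biadd e) (cobd tensor_coch n x) =
  cobd (coch (tensor M N)) n (gtens_lift (fun p q e => cup_biadd e) x).
Proof.
apply: (gtens_additive_ext
  (f := gtens_lift (fun p q e => cup_biadd e) \o cobd tensor_coch n)
  (g := cobd (coch (tensor M N)) n \o gtens_lift (fun p q e => cup_biadd e))).
move=> p q e a b /=; rewrite gtens_lift_pure cotens_cobd_pure.
by rewrite raddfD raddf_sgn /= !gtens_lift_pure [RHS]cobd_cup.
Qed.

Definition cup_map : cochain_map tensor_coch (coch (tensor M N)) :=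
  @CochainMap tensor_coch (coch (tensor M N))
    (fun n => gtens_lift (fun p q (e : (p + q)%N = n) => cup_biadd e))
    cup_map_cobd.

Lemma cup_map_pure p q n (e : (p + q)%N = n) a b :
  cup_map n (gpure e a b) = cup e a b.
Proof. exact: gtens_lift_pure. Qed.

(* The map C(G, M) (x) C(G, N) -> Hom_G(F (x) F, M (x) N) induced by x. *)
Definition cross_map n :
    {additive tensor_coch n ->
       ghom (tens_complex (std_complex G) (std_complex G) n) (tensor M N)} :=
  gtens_lift (fun p q (e : (p + q)%N = n) => cross_biadd M N e).

Lemma cross_map_pure p q n (e : (p + q)%N = n) a b :
  cross_map n (gpure e a b) = cross e a b.
Proof. exact: gtens_lift_pure. Qed.

End Cup.

Section CupBar.
Variables (G : groupType) (M N : gmodType G).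

(* t_* : C(G, N (x) M) -> C(G, M (x) N). *)
Definition t_star n :
    {additive coch (tensor N M) n -> coch (tensor M N) n} :=
  postcomp (swap_ghom N M).

Definition cupbar p q n (e : (p + q)%N = n) (a : coch M p) (b : coch N q) :
  coch (tensor M N) n := t_star n (cup (addC_eq e) b a) *~ (-1) ^+ (p * q).

Lemma cupbarDl p q n (e : (p + q)%N = n) b : {morph cupbar e ^~ b : a a' / a + a'}.
Proof.
move=> a a'; rewrite /cupbar -mulrzDl -raddfD.
by congr (t_star n _ *~ _); exact: (biaddDr (cup_biadd N M (addC_eq e))).
Qed.
Lemma cupbarDr p q n (e : (p + q)%N = n) a : {morph cupbar e a : b b' / b + b'}.
Proof.
move=> b b'; rewrite /cupbar -mulrzDl -raddfD.
by congr (t_star n _ *~ _); exact: (biaddDl (cup_biadd N M (addC_eq e))).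
Qed.

Definition cupbar_biadd p q n (e : (p + q)%N = n) :
    biadd (coch M p) (coch N q) (coch (tensor M N) n) :=
  Biadd (cupbarDl e) (cupbarDr e).

Lemma cobd_t_star n c :
  cobd (coch (tensor M N)) n (t_star n c) =
  t_star n.+1 (cobd (coch (tensor N M)) n c).
Proof. exact: ghom_ext. Qed.

Lemma cobd_cupbar p q n (e : (p + q)%N = n) (a : coch M p) (b : coch N q) :
  cobd (coch (tensor M N)) n (cupbar e a b) =
  cupbar (addSn_eq e) (cobd (coch M) p a) b
  + cupbar (addnS_eq e) a (cobd (coch N) q b) *~ (-1) ^+ p.
Proof.
rewrite /cupbar raddf_sgn cobd_t_star cobd_cup raddfD raddf_sgn mulrzDl addrC.
rewrite (eq_irrelevance (addnS_eq (addC_eq e)) (addC_eq (addSn_eq e))).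
rewrite (eq_irrelevance (addSn_eq (addC_eq e)) (addC_eq (addnS_eq e))).
rewrite -!mulrzA -!exprD; congr (_ + _); apply: sgn_congr;
  by rewrite !(oddD, oddM) /=; case: (odd p); case: (odd q).
Qed.

Lemma cupbar_map_cobd n x :
  gtens_lift (fun p q e => cupbar_biadd e) (cobd (tensor_coch M N) n x) =
  cobd (coch (tensor M N)) n (gtens_lift (fun p q e => cupbar_biadd e) x).
Proof.
apply: (gtens_additive_ext
  (f := gtens_lift (fun p q e => cupbar_biadd e) \o cobd (tensor_coch M N) n)
  (g := cobd (coch (tensor M N)) n \o gtens_lift (fun p q e => cupbar_biadd e))).
move=> p q e a b /=; rewrite gtens_lift_pure cotens_cobd_pure.
by rewrite raddfD raddf_sgn /= !gtens_lift_pure [RHS]cobd_cupbar.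
Qed.

Definition cupbar_map : cochain_map (tensor_coch M N) (coch (tensor M N)) :=
  @CochainMap (tensor_coch M N) (coch (tensor M N))
    (fun n => gtens_lift (fun p q (e : (p + q)%N = n) => cupbar_biadd e))
    cupbar_map_cobd.

Lemma cupbar_map_pure p q n (e : (p + q)%N = n) a b :
  cupbar_map n (gpure e a b) = cupbar e a b.
Proof. exact: gtens_lift_pure. Qed.

End CupBar.

Section Induced.
Variables (G : groupType).
Local Notation F := (std_complex G).
Local Notation FF := (tens_complex F F).

(* h_s(a) = a phi. *)
Definition pullback (phi : shifted F F) (M : gmodType G) :
  coshifted (coch M) (coch M) := fun n => precomp (phi n).

(* h(a (x) b) = (a x b) lambda. *)
Definition cross_pullback (lambda : shifted F FF) (M N : gmodType G) :
    coshifted (tensor_coch M N) (coch (tensor M N)) :=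
  fun n => precomp (lambda n) \o cross_map M N n.+1.

Lemma cross_pullback_pure (lambda : shifted F FF) (M N : gmodType G) p q n
    (e : (p + q)%N = n.+1) (a : coch M p) (b : coch N q) :
  cross_pullback lambda M N n (gpure e a b) = ghom_comp (cross e a b) (lambda n).
Proof. by rewrite /cross_pullback /= gtens_lift_pure. Qed.

End Induced.

(* Main.v *)
(* Hom_G(-, M) turns a homotopy f ~ g of chain maps X -> Y into a homotopy
   f^* ~ g^*, by precomposition.  Part (i) is the case f = tau_s, g = 1.  For
   part (ii), apply this to tau Delta ~ Delta with coefficients in M (x) N and
   restrict along the cross product, which is a cochain map
   C(G, M) (x) C(G, N) -> Hom_G(F (x) F, M (x) N) satisfying
   Delta^* (a x b) = a cup b and (tau Delta)^* (a x b) = a cupbar b. *)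
Require Import Defs.
From HB Require Import structures.
From mathcomp Require Import all_boot all_algebra.

Set Implicit Arguments.
Unset Strict Implicit.
Unset Printing Implicit Defensive.

Import GRing.Theory.
Local Open Scope ring_scope.

Section HomHomotopy.
Variables (G : groupType) (X Y : chain_complex G) (M : gmodType G).

Lemma hom_map_bd (f : chain_map X Y) n (c : hom_complex Y M n) :
  precomp (f n.+1) (cobd (hom_complex Y M) n c) =
  cobd (hom_complex X M) n (precomp (f n) c).
Proof. by apply: ghom_ext => x; congr (c _); rewrite /= chain_map_bd. Qed.

Definition hom_map (f : chain_map X Y) :
    cochain_map (hom_complex Y M) (hom_complex X M) :=
  @CochainMap (hom_complex Y M) (hom_complex X M) (fun n => precomp (f n))
    (@hom_map_bd f).

Definition hom_shifted (h : shifted X Y) :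
    coshifted (hom_complex Y M) (hom_complex X M) :=
  fun n => precomp (h n).

(** Additivity of [c] turns [bd h + h bd] into [c bd h], which is [h^*(d c)], plus [c h bd], which
    is [d(h^* c)]. No sign enters, as [d] is plain precomposition with [bd]. *)
Lemma hom_homotopy (f g : chain_map X Y) (h : shifted X Y) :
  chain_homotopy f g h -> cochain_homotopy (hom_map f) (hom_map g) (hom_shifted h).
Proof.
move=> [fg0 fgS] [|n] c; apply: ghom_ext => x.
  by rewrite -[LHS]/(c _ - c _) -raddfB fg0.
by rewrite -[LHS]/(c _ - c _) -raddfB fgS raddfD.
Qed.

End HomHomotopy.

Section CrossMap.
Variables (G : groupType) (M N : gmodType G).
Local Notation F := (std_complex G).
Local Notation FF := (tens_complex F F).

(** The sign of [x (x) bd y] is [(-1)^(deg x)], and [a] sees only [deg x = p]. *)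
Lemma cobd_cross p q n (e : (p + q)%N = n) (a : coch M p) (b : coch N q) :
  cobd (hom_complex FF (tensor M N)) n (cross e a b) =
  cross (addSn_eq e) (cobd (coch M) p a) b
  + cross (addnS_eq e) a (cobd (coch N) q b) *~ (-1) ^+ p.
Proof.
apply: ghom_ext => u; rewrite ghomDE ghomMzE.
(* Only the [(p, q)] component of the boundary is read; by definition it has two terms. *)
rewrite -[LHS]/(tensor_map a b (_ + _ *~ _)) raddfD raddf_sgn /=.
by rewrite !tensor_map_comp.
Qed.

Lemma cross_map_cobd n (u : tensor_coch M N n) :
  cross_map M N n.+1 (cobd (tensor_coch M N) n u) =
  cobd (hom_complex FF (tensor M N)) n (cross_map M N n u).
Proof.
apply: (gtens_additive_ext
  (f := cross_map M N n.+1 \o cobd (tensor_coch M N) n)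
  (g := cobd (hom_complex FF (tensor M N)) n \o cross_map M N n)).
move=> p q e a b; rewrite [LHS]/= [RHS]/= gtens_lift_pure cotens_cobd_pure.
by rewrite raddfD raddf_sgn /= !gtens_lift_pure [RHS]cobd_cross.
Qed.

Lemma cross_AW n (u : tensor_coch M N n) :
  hom_map (tensor M N) (AW G) n (cross_map M N n u) = cup_map M N n u.
Proof.
apply: (gtens_additive_ext
  (f := hom_map (tensor M N) (AW G) n \o cross_map M N n) (g := cup_map M N n)).
by move=> p q e a b; rewrite [LHS]/= cup_map_pure cross_map_pure.
Qed.

(** The Koszul sign of [tau] supplies the factor [(-1)^(pq)] of [cupbar], and its swap supplies
    [t_star]. *)
Lemma cross_tau_AW n (u : tensor_coch M N n) :
  hom_map (tensor M N) (chain_comp (tau F F) (AW G)) n (cross_map M N n u) =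
  cupbar_map M N n u.
Proof.
apply: (gtens_additive_ext
  (f := hom_map (tensor M N) (chain_comp (tau F F) (AW G)) n \o cross_map M N n)
  (g := cupbar_map M N n)).
move=> p q e a b; rewrite [LHS]/= cupbar_map_pure cross_map_pure.
apply: ghom_ext => x; rewrite ghomMzE.
rewrite -[LHS]/(tensor_map a b (tensor_swap _ *~ _)) raddf_sgn /=.
(* Naturality moves the swap from the argument to the values, exchanging [a] and [b]. *)
by rewrite -tensor_swap_map.
Qed.

(** The [dh] terms agree by definition; the [hd] terms agree because [cross_map] commutes with
    [d]. *)
Lemma hd_dh_cross_pullback (lambda : shifted F FF) n (u : tensor_coch M N n) :
  hd_dh (cross_pullback lambda M N) u =
  hd_dh (hom_shifted (tensor M N) lambda) (cross_map M N n u).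
Proof. by case: n u => [|n] u; rewrite /= -cross_map_cobd. Qed.

End CrossMap.

Theorem theorem1p1 (G : groupType) :
  (forall (s : G) (phi : shifted (std_complex G) (std_complex G)),
     chain_homotopy (tau_tr s) (chain_id (std_complex G)) phi ->
     forall M : gmodType G,
       cochain_homotopy (coch_act M s) (cochain_id (coch M)) (pullback phi M))
  /\
  (forall lambda : shifted (std_complex G)
                     (tens_complex (std_complex G) (std_complex G)),
     chain_homotopy
       (chain_comp (tau (std_complex G) (std_complex G)) (AW G)) (AW G) lambda ->
     forall M N : gmodType G,
       cochain_homotopy (cupbar_map M N) (cup_map M N) (cross_pullback lambda M N)
       /\
       forall (p q n : nat) (e : (p + q)%N = n) (a : coch M p) (b : coch N q),
         t_star M N n (cup (addC_eq e) b a) *~ (-1) ^+ (p * q) - cup e a b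
         = hd_dh (cross_pullback lambda M N) (gpure e a b)).
Proof.
split=> [s phi phiP M n a | lambda lambdaP M N].
  (* [pullback phi M] unfolds to [hom_shifted M phi], so it remains to see the action of [s] as
     precomposition with [tau_tr s]. *)
  rewrite -[RHS](hom_homotopy phiP a); congr (_ - _); apply: ghom_ext => x //.
  exact: coch_actE.
have cupP : cochain_homotopy (cupbar_map M N) (cup_map M N)
              (cross_pullback lambda M N).
  move=> n u; rewrite hd_dh_cross_pullback -(hom_homotopy lambdaP).
  by rewrite cross_AW cross_tau_AW.
split=> // p q n e a b.
by rewrite -cupP cupbar_map_pure cup_map_pure.
Qed.
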